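(* Let $n\in\mathbb{N}$ and let $\epsilon\in\mathbb{N}$. An opinion distribution $p\in\triangle^{n-1}\subset\mathbb{R}^n$ is a fixed point of the interactive Markov chain $p(t+1)=p(t)B^{\mathrm{HK}}(p(t),\epsilon)$ with Hegselmann-Krause transition matrix and discrete bound of confidence $\epsilon$ (that is, $p=pB^{\mathrm{HK}}(p,\epsilon)$) if and only if for all $k\in\{1,\dots,n\}$ it holds that $$p_k>0\ \Longrightarrow\ p_m=0 \text{ for all } m\in\{k-\epsilon,\dots,k-2,\,k+2,\dots,k+\epsilon\}\cap\{1,\dots,n\}.$$
   Context: $\mathbb{N}$ denotes the positive integers. $\triangle^{n-1}=\{p\in\mathbb{R}^n_{\ge0} \mid \sum_{i=1}^n p_i=1\}$; its elements (opinion distributions) are treated as row vectors, and by convention $p_i=0$ for all integers $i\notin\{1,\dots,n\}$. The index set $\{k-\epsilon,\dots,k-2,k+2,\dots,k+\epsilon\}$ consists of the integers $m$ with $2\le|m-k|\le\epsilon$. For a finite nonempty interval of integers $I$ the $I$-barycenter of $p$ is $$M_I^{\mathrm{bary}}(p)=\frac{\sum_{k\in I}k\,p_k}{\sum_{k\in I}p_k}\ \text{ if } p_k\neq0 \text{ for some } k\in I,\qquad M_I^{\mathrm{bary}}(p)=\frac{\max I+\min I}{2}\ \text{ otherwise.}$$ For $i\in\{1,\dots,n\}$ the $\epsilon$-local mean is $M_i:=M^{\mathrm{bary}}_{\{i-\epsilon,\,i-\epsilon+1,\dots,\,i+\epsilon\}}(p)$. The Hegselmann-Krause transition matrix $B^{\mathrm{HK}}(p,\epsilon)$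 is the $n\times n$ matrix with $$B^{\mathrm{HK}}_{ij}(p,\epsilon)=\begin{cases}1 & \text{if } j=M_i,\\ \lceil M_i\rceil-M_i & \text{if } j=\lfloor M_i\rfloor,\ j\ne M_i,\\ M_i-\lfloor M_i\rfloor & \text{if } j=\lceil M_i\rceil,\ j\neq M_i,\\ 0&\text{otherwise.}\end{cases}$$
   Formalization: The case ε = 1 with n ≥ 3 is excluded, since the claim fails there: for n = 3, ε = 1, p = (1/3,1/3,1/3) the condition on p is vacuous, but pB = (1/6,2/3,1/6) ≠ p, and padding with zeros refutes every n ≥ 3. *)

(* Defs.v *)
From HB Require Import structures.
From mathcomp Require Import all_boot all_order all_algebra.
From mathcomp Require Import reals.
Set Implicit Arguments.
Unset Strict Implicit.
Unset Printing Implicit Defensive.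
Import Order.TTheory GRing.Theory Num.Theory.
Local Open Scope ring_scope.

(* Opinions are the integers 1, ..., n, whereas the entries of a row vector
   are indexed by 'I_n = {0, ..., n-1}: entry i carries the opinion i + 1. *)
Definition label (n : nat) (i : 'I_n) : int := i.+1%:Z.

Definition opinion_distribution (R : realType) (n : nat) (p : 'rV[R]_n) : Prop :=
  (forall i, 0 <= p 0 i) /\ \sum_i p 0 i = 1.

(* p_k for an arbitrary integer k, equal to 0 outside {1, ..., n}. *)
Definition mass (R : realType) (n : nat) (p : 'rV[R]_n) (k : int) : R :=
  \sum_(i | label i == k) p 0 i.

Definition int_itv (a b : int) : seq int :=
  if a <= b then [seq a + d%:Z | d <- iota 0 (absz (b - a)).+1] else [::].

Lemma int_itv_uniq (a b : int) : uniq (int_itv a b).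
Proof.
rewrite /int_itv; case: ifP => // _.
by rewrite map_inj_uniq ?iota_uniq // => c d /addrI [].
Qed.

Lemma mem_int_itv (a b k : int) : (k \in int_itv a b) = (a <= k <= b).
Proof.
rewrite /int_itv; case: ifPn => [leab | nleab]; last first.
  by apply/esym/negP => /andP[ak kb]; move/negP: nleab; apply; apply: le_trans kb.
have eab : (absz (b - a))%:Z = b - a by rewrite gez0_abs ?subr_ge0.
apply/mapP/andP => [[d] | [leak lekb]].
  rewrite mem_iota add0n ltnS => /andP[_ led] ->; split; first by rewrite lerDl.
  by rewrite -lerBrDl -eab lez_nat.
have eak : (absz (k - a))%:Z = k - a by rewrite gez0_abs ?subr_ge0.
exists (absz (k - a)); last by rewrite eak addrC subrK.
have : (absz (k - a))%:Z <= (absz (b - a))%:Z by rewrite eak eab lerD2r.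
by rewrite mem_iota add0n ltnS lez_nat.
Qed.

(* The I-barycenter for I = {a, ..., b}, meaningful when a <= b. *)
Definition bary (R : realType) (n : nat) (p : 'rV[R]_n) (a b : int) : R :=
  if has (fun k => mass p k != 0) (int_itv a b)
  then (\sum_(k <- int_itv a b) k%:~R * mass p k) /
       (\sum_(k <- int_itv a b) mass p k)
  else (b%:~R + a%:~R) / 2.

Definition local_mean (R : realType) (n : nat) (p : 'rV[R]_n) (eps : nat)
    (i : 'I_n) : R :=
  bary p (label i - eps%:Z) (label i + eps%:Z).

Definition HKmx (R : realType) (n : nat) (p : 'rV[R]_n) (eps : nat) : 'M[R]_n :=
  \matrix_(i, j)
    let M := local_mean p eps i in
    if (label j)%:~R == M then 1
    else if label j == Num.floor M then (Num.ceil M)%:~R - M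
    else if label j == Num.ceil M then M - (Num.floor M)%:~R
    else 0.

(* Main.v *)
(** Let M_i be the local mean at i and W_i the mass of its window.  The entry
    B_ij is the hat function max(0, 1 - |M_i - j|), and on the support of p the
    map i |-> M_i is nondecreasing.

    If p is fixed, scan the support from the left.  Suppose that no window of an
    earlier support point reaches a support point >= a, and that p_a > 0.  Then
    all mass entering a comes from support points >= a, and by monotonicity of M
    and conservation of the mass of {a, a+1} it comes from {a, a+1} only.  For i in
    this pair, W_i (a + 1 - M_i) = p_a - sum_{j >= a+2} p_j (j - a - 1), where j
    runs over the window of i, and W_i >= s := p_a + p_(a+1), so s B_ia <= p_a,
    strictly if the window of i has mass beyond a + 1.  As s p_a is the sum of
    p_i s B_ia over the pair, no such mass exists, and the scan resumes at a + 2.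

    Conversely, if the support splits into singletons and pairs of neighbours,
    then row i of B, for i in the support, is p restricted to the window of i and
    normalized, so p_i B_ij = p_i p_j / W_i is symmetric in i and j: p satisfies
    detailed balance. *)
Require Import Defs.
From HB Require Import structures.
From mathcomp Require Import all_boot all_order all_algebra.
From mathcomp Require Import reals.
From mathcomp Require Import zify ring lra.
Set Implicit Arguments.
Unset Strict Implicit.
Unset Printing Implicit Defensive.
Import Order.TTheory GRing.Theory Num.Theory.
Local Open Scope ring_scope.

(** * Windows, labels and the hat function *)

Definition win (e i j : nat) : bool := ((i <= j + e) && (j <= i + e))%N.

Lemma win_refl e i : win e i i.
Proof. by rewrite /win; lia. Qed.

Lemma win_sym e i j : win e i j = win e j i.
Proof. by rewrite /win andbC. Qed.

Lemma win_label n e (i j : 'I_n) :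
  (label i - e%:Z <= label j <= label i + e%:Z) = win e i j.
Proof. by rewrite /win /label; lia. Qed.

Lemma label_natr (R : realType) n (i : 'I_n) : (label i)%:~R = i.+1%:R :> R.
Proof. by rewrite /label -pmulrn. Qed.

Lemma mass_label (R : realType) n (p : 'rV[R]_n) i : mass p (label i) = p 0 i.
Proof.
rewrite /mass (eq_bigl (pred1 i)) ?big_pred1_eq // => j.
Qed.

(** After exchanging the sums, the inner one keeps only [k = label i]; barycenters thus become sums
    over indices. *)
Lemma sum_mass (R : realType) n (p : 'rV[R]_n) (a b : int) (F : int -> R) :
  \sum_(k <- int_itv a b) F k * mass p k
  = \sum_(i | a <= label i <= b) F (label i) * p 0 i.
Proof.
under eq_bigr do rewrite /mass mulr_sumr big_mkcond.
rewrite exchange_big [RHS]big_mkcond /=; apply: eq_bigr => i _.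
rewrite -big_mkcond -mem_int_itv; case: ifPn => hi.
  under eq_bigl do rewrite eq_sym.
  by rewrite -big_filter filter_pred1_uniq ?int_itv_uniq // big_seq1.
rewrite big_seq_cond big1 // => k /andP[hk /eqP e].
by rewrite e hk in hi.
Qed.

(** If the mean is an integer, every other label is at distance at least 1; otherwise the ceiling is
    the floor plus 1, and both middle cases are linear in the distance. *)
Lemma HKmxE (R : realType) n (p : 'rV[R]_n) e i j :
  HKmx p e i j = Num.max 0 (1 - `|local_mean p e i - j.+1%:R|).
Proof.
rewrite mxE /=; set M := local_mean p e i; rewrite -label_natr; set l := label j.
have [<-|ne] := eqVneq; first by rewrite subrr normr0 subr0; apply/esym/max_idPr.
have h1 : (Num.floor M)%:~R <= M by exact: floor_le.
have h2 : M < (Num.floor M + 1)%:~R by exact: floorD1_gt.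
have [Mi|Mi] := boolP (M \is a Num.int).
  rewrite !ifN; last first.
  - by apply: contraNneq ne => ->; rewrite floorK.
  - by apply: contraNneq ne => ->; rewrite ceilK.
  apply/esym/max_idPl; move: ne; rewrite -(floorK Mi) -intrB eqr_int.
  rewrite -intr_norm -(intrB _ 1) lerz0; lia.
have c1 : Num.ceil M = Num.floor M + 1 by rewrite ceil_floor Mi.
have [lf|nf] := eqVneq l (Num.floor M).
  rewrite c1 lf intrD ger0_norm; last by lra.
  by rewrite intrD in h2; apply/esym/eqP; rewrite maxEle ifT; [apply/eqP; lra|lra].
rewrite c1 !intrD /= in h2 *.
have [lf|nc] := eqVneq l (Num.floor M + 1).
  rewrite lf intrD /= ler0_norm; last by lra.
  by rewrite maxEle ifT; lra.
apply/esym/max_idPl.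
have [ll|ll] := ltP l (Num.floor M).
  have : (l + 1)%:~R <= (Num.floor M)%:~R :> R by rewrite ler_int; lia.
  by rewrite intrD /= => h; rewrite ger0_norm; lra.
have : (Num.floor M + 2)%:~R <= l%:~R :> R by rewrite ler_int; lia.
by rewrite intrD /= => h; rewrite ler0_norm; lra.
Qed.

(** * Local means on the support *)

Section Chain.
Variables (R : realType) (n eps : nat) (p : 'rV[R]_n).
Hypothesis p_ge0 : forall i, 0 <= p 0 i.

Local Notation M := (local_mean p eps).
Local Notation B := (HKmx p eps).
Let W (i : 'I_n) : R := \sum_(j < n | win eps i j) p 0 j.

Lemma window_mass_gt0 i : 0 < p 0 i -> 0 < W i.
Proof.
move=> pi; rewrite /W (bigD1 i) ?win_refl //= ltr_pwDl //.
by apply: sumr_ge0 => j _.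
Qed.

(** Clears the denominator [W i]; the free base point [c] turns comparisons of the mean with [c]
    into signs of sums. *)
Lemma local_mean_sub c i : 0 < p 0 i ->
  W i * (M i - c) = \sum_(j < n | win eps i j) p 0 j * (j.+1%:R - c).
Proof.
move=> pi; have W0 := window_mass_gt0 pi.
have -> : \sum_(j < n | win eps i j) p 0 j * (j.+1%:R - c) =
    (\sum_(j < n | win eps i j) p 0 j * j.+1%:R) - W i * c.
  by rewrite /W mulr_suml -sumrB; apply: eq_bigr => j _; rewrite mulrBr.
rewrite mulrBr; congr (_ - _); rewrite /local_mean /bary ifT; last first.
  apply/hasP; exists (label i); last by rewrite mass_label gt_eqF.
  by rewrite mem_int_itv win_label win_refl.
have -> : \sum_(k <- int_itv (label i - eps%:Z) (label i + eps%:Z)) mass p k = W i.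
  under eq_bigr do rewrite -[mass p _]mul1r.
  rewrite (sum_mass p _ _ (fun=> 1)) (eq_bigl _ _ (win_label eps i)).
  by apply: eq_bigr => j _; rewrite mul1r.
rewrite (sum_mass p _ _ (fun k => k%:~R)) (eq_bigl _ _ (win_label eps i)).
rewrite mulrC divfK ?gt_eqF //.
by apply: eq_bigr => j _; rewrite label_natr mulrC.
Qed.

Lemma local_mean_ge c i : 0 < p 0 i ->
  (forall j : 'I_n, win eps i j -> 0 < p 0 j -> c <= j.+1%:R) -> c <= M i.
Proof.
move=> pi h; rewrite -subr_ge0 -(pmulr_rge0 _ (window_mass_gt0 pi)).
rewrite local_mean_sub //; apply: sumr_ge0 => j wj.
have := p_ge0 j; rewrite le_eqVlt => /predU1P[<-|pj]; first by rewrite mul0r.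
by rewrite mulr_ge0 // subr_ge0 h.
Qed.

Lemma local_mean_le c i : 0 < p 0 i ->
  (forall j : 'I_n, win eps i j -> 0 < p 0 j -> j.+1%:R <= c) -> M i <= c.
Proof.
move=> pi h; rewrite -subr_le0 -(pmulr_rle0 _ (window_mass_gt0 pi)).
rewrite local_mean_sub //; apply: sumr_le0 => j wj.
have := p_ge0 j; rewrite le_eqVlt => /predU1P[<-|pj]; first by rewrite mul0r.
by rewrite mulr_ge0_le0 // subr_le0 h.
Qed.

(* Antisymmetrize the double sum of p_j p_k (k - j) over j in the window of i
   and k in the window of i': every term of the result is nonnegative. *)
Lemma local_mean_mono (i i' : 'I_n) : 0 < p 0 i -> 0 < p 0 i' -> (i <= i')%N ->
  M i <= M i'.
Proof.
move=> pi pi' ii'; have Wi := window_mass_gt0 pi; have Wi' := window_mass_gt0 pi'.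
rewrite -subr_ge0 -(pmulr_rge0 _ Wi) -(pmulr_rge0 _ Wi').
pose G (j k : 'I_n) : R :=
  if win eps i j && win eps i' k then p 0 j * p 0 k * (k%:R - j%:R) else 0.
have -> : W i' * (W i * (M i' - M i)) = \sum_j \sum_k G j k.
  have -> : W i' * (W i * (M i' - M i)) =
      W i * (W i' * (M i' - 1)) - W i' * (W i * (M i - 1)) by ring.
  rewrite !local_mean_sub // [X in _ - X]mulr_sumr [W i]/W mulr_suml -sumrB big_mkcond.
  apply: eq_bigr => j _.
  rewrite /G; case: (win eps i j) => /=; last by rewrite big1.
  rewrite mulr_sumr /W mulr_suml -sumrB big_mkcond; apply: eq_bigr => k _.
  by case: ifP => // _; rewrite -!natr1; ring.
suff : 0 <= \sum_j \sum_k (G j k + G k j).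
  under eq_bigr do rewrite big_split /=.
  rewrite big_split /= [X in _ + X]exchange_big /=; lra.
apply: sumr_ge0 => j _; apply: sumr_ge0 => k _.
have pjk : 0 <= p 0 j * p 0 k by rewrite mulr_ge0.
rewrite /G; have [jk|kj] := leqP j k.
  have jkR : (j%:R : R) <= k%:R by rewrite ler_nat.
  case: ifPn => h1; case: ifPn => h2; rewrite ?addr0 ?add0r //; try nra.
  (* The negative term never stands alone: as [i <= i'] and [j <= k], uncrossing the two pairs keeps
     them inside the windows. *)
  by exfalso; move: h1 h2; rewrite /win; lia.
have jkR : (k%:R : R) <= j%:R by rewrite ler_nat ltnW.
case: ifPn => h1; case: ifPn => h2; rewrite ?addr0 ?add0r //; try nra.
by exfalso; move: h1 h2; rewrite /win; lia.
Qed.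

Lemma HKmx_ge0 i j : 0 <= B i j.
Proof. by rewrite HKmxE le_max lexx. Qed.

Lemma fixedE : p = p *m B <-> forall j, \sum_i p 0 i * B i j = p 0 j.
Proof.
split=> [h j|h]; first by rewrite {3}h mxE.
by apply/rowP => j; rewrite mxE h.
Qed.

(** Invariant of the scan: windows being symmetric, the mean of a support point depends only on its
    own side of [c]. *)
Definition cut (c : nat) : Prop := forall i j : 'I_n,
  0 < p 0 i -> 0 < p 0 j -> (i < c)%N -> (c <= j)%N -> (i + eps < j)%N.

(** * One step of the scan, from [a] past [a + 1] *)

Section Step.
Hypothesis eps_gt0 : (0 < eps)%N.
Hypothesis fixed : forall j, \sum_i p 0 i * B i j = p 0 j.
Variable a : 'I_n.
Hypotheses (cut_a : cut a) (pa : 0 < p 0 a).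

Lemma local_mean_ge_cut i : 0 < p 0 i -> (a <= i)%N -> a.+1%:R <= M i.
Proof.
move=> pi ai; apply: local_mean_ge => // j wj pj; rewrite ler_nat ltnS.
rewrite leqNgt; apply/negP => ja; have := cut_a pj pi ja ai.
by move: wj; rewrite /win; lia.
Qed.

Lemma HKmx_below_cut i : 0 < p 0 i -> (i < a)%N -> B i a = 0.
Proof.
move=> pi ia; rewrite HKmxE; apply/max_idPl.
(* [a%:R] is the label of the index just below [a], a full unit left of the center [a.+1] of the
   hat. *)
have : M i <= a%:R.
  apply: local_mean_le => // j wj pj; rewrite ler_nat.
  rewrite ltnNge; apply/negP => ja; have := cut_a pi pj ia ja.
  by move: wj; rewrite /win; lia.
by move=> h; rewrite -natr1 ler0_norm; lra.
Qed.

Lemma HKmx_above_cut i : 0 < p 0 i -> (a <= i)%N ->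
  B i a = Num.max 0 (a.+2%:R - M i).
Proof.
move=> pi ai; have := local_mean_ge_cut pi ai => h.
by rewrite HKmxE ger0_norm ?subr_ge0 // -(natr1 a.+1); congr Num.max; ring.
Qed.

(* Otherwise a and a + 1 would send all their mass to themselves, and i would
   send them some more. *)
Lemma HKmx_beyond_pair i : 0 < p 0 i -> (a.+2 <= i)%N -> B i a = 0.
Proof.
move=> pi ai; have ai' : (a <= i)%N by lia.
rewrite HKmx_above_cut //; apply/max_idPl; rewrite subr_le0 leNgt; apply/negP => Mi.
have la' : (a.+1 < n)%N by have := ltn_ord i; lia.
pose a' := Ordinal la'.
(* By monotonicity the means from [a] to [i] lie between the labels of [a] and [a'], where the two
   hats add up to 1. *)
have full (k : 'I_n) : 0 < p 0 k -> (a <= k)%N -> (k <= i)%N -> B k a + B k a' = 1.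
  move=> pk ak ki; have h1 := local_mean_ge_cut pk ak.
  have h2 := le_lt_trans (local_mean_mono pk pi ki) Mi.
  rewrite HKmx_above_cut // HKmxE /= maxEle ifT; last by lra.
  by rewrite ler0_norm; [rewrite maxEle ifT -(natr1 a.+1) in h2 *; lra|lra].
have full' (k : 'I_n) : (a <= k)%N -> (k <= i)%N -> p 0 k * (B k a + B k a') = p 0 k.
  move=> ak ki; have := p_ge0 k; rewrite le_eqVlt => /predU1P[<-|pk].
    by rewrite mul0r.
  by rewrite full // mulr1.
have : \sum_k p 0 k * (B k a + B k a') = p 0 a + p 0 a'.
  by rewrite -!fixed -big_split; apply: eq_bigr => k _; rewrite mulrDr.
have aa' : a' != a by apply/eqP => /(congr1 val) /=; lia.
have ia : i != a by apply/eqP => /(congr1 val) /=; lia.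
have ia' : i != a' by apply/eqP => /(congr1 val) /=; lia.
rewrite (bigD1 a) //= (bigD1 a') //= (bigD1 i) ?ia //= !full' //=; try lia.
have : 0 <= \sum_(k < n | (k != a) && (k != a') && (k != i)) p 0 k * (B k a + B k a').
  by apply: sumr_ge0 => k _; rewrite mulr_ge0 // addr_ge0 // HKmx_ge0.
lra.
Qed.

Let s : R := \sum_(j < n | (a <= j < a.+2)%N) p 0 j.

(** As [eps >= 1], the two members of the pair see each other. *)
Lemma pair_mass_le (i : 'I_n) : (a <= i < a.+2)%N -> s <= W i.
Proof.
move=> ai; rewrite /s /W big_mkcond [leRHS]big_mkcond; apply: ler_sum => j _.
case: ifP => // h1; case: ifP => // h2; exfalso.
by move: h1 h2; rewrite /win; lia.
Qed.

Lemma pair_mass_gt0 : 0 < s.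
Proof.
rewrite /s (bigD1 a) /=; last by lia.
by rewrite ltr_pwDl // sumr_ge0.
Qed.

(** Relative to the base point [a.+2], the label of [a + 1], the index [a] contributes [p 0 a] and
    [a + 1] nothing; the cut empties the window below [a]. *)
Lemma pair_flow (i : 'I_n) : 0 < p 0 i -> (a <= i < a.+2)%N ->
  W i * (a.+2%:R - M i) =
  p 0 a - \sum_(j < n | win eps i j && (a < j)%N) p 0 j * (j.+1%:R - a.+2%:R).
Proof.
move=> pi ai; rewrite -opprB mulrN local_mean_sub // (bigD1 a) /=; last first.
  by move: ai; rewrite /win; lia.
rewrite opprD; congr (_ + _); first by rewrite -(natr1 a.+1); ring.
rewrite (bigID (fun j : 'I_n => (a < j)%N)) /= [X in _ + X]big1 ?addr0.
  congr (- _); apply: eq_bigl => j.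
  rewrite -andbA; congr (_ && _); apply/andP/idP => [[]//|aj]; split=> //.
  by apply/eqP => /(congr1 val) /=; lia.
move=> j /andP[/andP[wj ja] aj].
have := p_ge0 j; rewrite le_eqVlt => /predU1P[<-|pj]; first by rewrite mul0r.
have jna : (j != a :> nat) by [].
have ja' : (j < a)%N by lia.
have := cut_a pj pi ja'; have /andP[ai1 _] := ai => /(_ ai1).
by move: wj; rewrite /win; lia.
Qed.

(** Serves with [b = 0] and with [b] the contribution of one point beyond the pair. Positivity opens
    the maximum, so that [s <= W i] applies. *)
Lemma pair_flow_bound (i : 'I_n) (b : R) :
  0 < p 0 i -> (a <= i < a.+2)%N -> 0 <= b ->
  b <= \sum_(j < n | win eps i j && (a < j)%N) p 0 j * (j.+1%:R - a.+2%:R) ->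
  0 < s * B i a -> s * B i a <= p 0 a - b.
Proof.
move=> pi ai b0 hb; have /andP[ai1 _] := ai.
rewrite pmulr_rgt0 ?pair_mass_gt0 // HKmx_above_cut // lt_max ltxx /= => h.
have -> : Num.max 0 (a.+2%:R - M i) = a.+2%:R - M i by apply/max_idPr/ltW.
apply: le_trans (_ : W i * (a.+2%:R - M i) <= _).
  by rewrite ler_pM2r // pair_mass_le.
by rewrite pair_flow // lerB.
Qed.

Lemma cut_step : cut a.+2.
Proof.
move=> i0 j0 pi0 pj0; rewrite ltnS => ia ja.
have [lai|lia] := leqP a i0; last by apply: cut_a => //; lia.
rewrite ltnNge; apply/negP => near.
have ge0 i (j : 'I_n) : win eps i j && (a < j)%N -> 0 <= p 0 j * (j.+1%:R - a.+2%:R).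
  by move=> /andP[_ aj]; rewrite mulr_ge0 // subr_ge0 ler_nat.
have le i : 0 < p 0 i -> (a <= i < a.+2)%N -> s * B i a <= p 0 a.
  move=> pi ai; rewrite -[p 0 a]subr0.
  have [h|h] := ltP 0 (s * B i a); last by rewrite subr0 (le_trans h).
  by apply: pair_flow_bound => //; apply: sumr_ge0 => j; apply: ge0.
have lt : s * B i0 a < p 0 a.
  have [h|h] := ltP 0 (s * B i0 a); last exact: le_lt_trans h _.
  have tpos : 0 < p 0 j0 * (j0.+1%:R - a.+2%:R).
    by rewrite mulr_gt0 // subr_gt0 ltr_nat.
  apply: (@le_lt_trans _ _ (p 0 a - p 0 j0 * (j0.+1%:R - a.+2%:R))); last by lra.
  apply: pair_flow_bound => //; [by lia|exact: ltW|].
  rewrite (bigD1 j0) /=; last by rewrite /win; lia.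
  by rewrite lerDl sumr_ge0 // => j /andP[h' _]; apply: ge0 h'.
(* Conservation of mass at [a], which only the pair feeds. *)
have : \sum_(i < n | (a <= i < a.+2)%N) p 0 i * (s * B i a) = s * p 0 a.
  rewrite -[in RHS]fixed mulr_sumr [LHS]big_mkcond; apply: eq_bigr => i _.
  case: ifPn => h; first by rewrite mulrCA.
  have := p_ge0 i; rewrite le_eqVlt => /predU1P[<-|pi]; first by rewrite mul0r mulr0.
  have [/(HKmx_below_cut pi)->|hi] := ltnP i a; first by rewrite !mulr0.
  by rewrite HKmx_beyond_pair ?mulr0 //; lia.
(* The weights [p 0 i] of the pair add up to [s], so the bounds by [p 0 a], strict at [i0],
   contradict this balance. *)
rewrite /s mulr_suml -/s; apply/eqP; rewrite lt_eqF //.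
have i0in : (a <= i0 < a.+2)%N by lia.
rewrite (bigD1 i0) //= [ltRHS](bigD1 i0) //=; apply: ltr_leD.
  by rewrite ltr_pM2l.
apply: ler_sum => i /andP[ai _].
have := p_ge0 i; rewrite le_eqVlt => /predU1P[<-|pi]; first by rewrite !mul0r.
by rewrite ler_pM2l // le.
Qed.

End Step.

(** * From fixed points to separated supports *)

Lemma fixed_separated : (0 < eps)%N ->
  (forall j, \sum_i p 0 i * B i j = p 0 j) ->
  forall i j : 'I_n, 0 < p 0 i -> 0 < p 0 j -> (i.+2 <= j)%N -> (i + eps < j)%N.
Proof.
move=> eps_gt0 fixed.
(* Either [c] is a cut, or it is the second place of a pair begun at a cut; in the latter case
   [cut_step] yields a cut at [c.+1]. *)
have inv c : cut c \/ exists2 a : 'I_n, c = a.+1 & cut a /\ 0 < p 0 a.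
  elim: c => [|c [cc|[a -> [ca pa]]]]; first by left.
    have [[a ea pa]|no] : (exists2 a : 'I_n, c = a & 0 < p 0 a) \/
        (forall a : 'I_n, c = a -> ~ 0 < p 0 a).
      have [cn|cn] := ltnP c n; last by right=> a ac; have := ltn_ord a; lia.
      have [h|h] := boolP (0 < p 0 (Ordinal cn)); first by left; exists (Ordinal cn).
      by right=> a ac; rewrite (_ : a = Ordinal cn); [exact/negP|exact: val_inj].
      by right; exists a; rewrite -?ea.
    left=> i j pi pj; rewrite ltnS leq_eqVlt => /predU1P[e|ic] cj.
      by case: (no i).
    by apply: cc => //; lia.
  by left; apply: cut_step.
move=> i j pi pj ij; have [ci|[a ia [ca pa]]] := inv i.
  (* Either way a cut falls at [i.+2] or [i.+1], hence between [i] and [j]. *)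
  by apply: (cut_step eps_gt0 fixed ci pi) => //; lia.
by apply: (cut_step eps_gt0 fixed ca pa) => //; lia.
Qed.

(** * Separated supports and detailed balance *)

Section Separated.
Hypothesis eps_big : (n <= 2)%N || (2 <= eps)%N.
Hypothesis separated : forall i j : 'I_n,
  0 < p 0 i -> 0 < p 0 j -> (i.+2 <= j)%N -> (i + eps < j)%N.

Lemma window_near (i j : 'I_n) : 0 < p 0 i -> 0 < p 0 j -> win eps i j ->
  (i <= j.+1)%N && (j <= i.+1)%N.
Proof.
move=> pi pj w; have := separated pi pj; have := separated pj pi.
by move: w; rewrite /win; lia.
Qed.

(** Support points in the window of [i] are [i] or its neighbours. Two distinct neighbours would be
    at distance 2, which [2 <= eps] forbids and [n <= 2] leaves no room for. *)
Lemma window_pair (i j k : 'I_n) : 0 < p 0 i -> 0 < p 0 j -> 0 < p 0 k ->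
  win eps i j -> win eps i k -> i != j -> k = i \/ k = j.
Proof.
move=> pi pj pk wj wk ij.
have := window_near pi pj wj; have := window_near pi pk wk.
have := separated pj pk; have := separated pk pj; move: eps_big ij wj wk.
have := ltn_ord i; have := ltn_ord j; have := ltn_ord k.
rewrite -(inj_eq val_inj) /win /= => *.
have [/val_inj|/val_inj] : (k = i :> nat) \/ (k = j :> nat) by lia.
  by left.
by right.
Qed.

Lemma far_label (i j : 'I_n) : i != j -> 1 <= `|i.+1%:R - j.+1%:R| :> R.
Proof.
move=> ij; rewrite -natr1 -(natr1 j) opprD addrACA subrr addr0.
have : (i : nat) != j by [].
rewrite neq_ltn => /orP[h|h]; have := h; rewrite -(ler_nat R) -natr1 => h'.
  by rewrite ler0_norm; lra.
by rewrite ger0_norm; lra.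
Qed.

(* A pair of neighbours is the only case where the rounding acts, and there the
   hat function interpolates linearly between the two. *)
Lemma HKmx_separated i j : 0 < p 0 i ->
  B i j = if win eps i j then p 0 j / W i else 0.
Proof.
move=> pi; have W0 := window_mass_gt0 pi; rewrite HKmxE.
have [/existsP[k /and3P[ki wk pk]]|] :=
    boolP [exists k, [&& k != i, win eps i k & 0 < p 0 k]]; last first.
  (* Alone in its window, [i] has its mean at its own label and keeps all its mass. *)
  rewrite negb_exists => /forallP no.
  have z (k : 'I_n) : k != i -> win eps i k -> p 0 k = 0.
    move=> ki wk; have := no k; rewrite ki wk /= lt_neqAle p_ge0 andbT negbK.
    by move/eqP.
  have only (k : 'I_n) : win eps i k -> 0 < p 0 k -> k = i.
    by move=> wk pk; apply/eqP; apply: contraLR pk => ki; rewrite z ?ltxx.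
  have -> : M i = i.+1%:R.
    apply/eqP; rewrite eq_le local_mean_le ?local_mean_ge // => k wk pk;
    by rewrite (only k).
  have -> : W i = p 0 i.
    by rewrite /W (bigD1 i) ?win_refl //= big1 ?addr0 // => k /andP[wk ki]; apply: z.
  have [->|ji] := eqVneq j i.
    by rewrite win_refl subrr normr0 subr0 divff ?gt_eqF //; apply/max_idPr.
  rewrite (_ : Num.max _ _ = 0); last first.
    by apply/max_idPl; have := @far_label i j; rewrite eq_sym ji => /(_ isT); lra.
  by case: ifP => // wj; rewrite z // mul0r.
have z (l : 'I_n) : win eps i l -> l != i -> l != k -> p 0 l = 0.
  move=> wl li lk; have := p_ge0 l; rewrite le_eqVlt => /predU1P[//|pl].
  have [] := window_pair pi pk pl wk wl; first by rewrite eq_sym.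
    by move=> e; rewrite e eqxx in li.
  by move=> e; rewrite e eqxx in lk.
have EW : W i = p 0 i + p 0 k.
  rewrite /W (bigD1 i) ?win_refl //= (bigD1 k) ?wk //= big1 ?addr0 // => l.
  by case/andP=> /andP[wl li] lk; apply: z.
(* The mean lies at the fraction [r] of the way from [i] to its neighbour [k]. *)
pose r := p 0 k / W i.
have r01 : 0 < r < 1.
  by rewrite divr_gt0 //= ltr_pdivrMr // mul1r EW ltrDr.
have Er : p 0 i / W i = 1 - r.
  by rewrite /r -[1](@divff _ (W i)) ?gt_eqF // -mulrBl EW addrK.
have EM : M i = i.+1%:R + r * (k.+1%:R - i.+1%:R).
  apply/eqP; rewrite -subr_eq0 opprD addrA -(mulrI_eq0 _ (mulfI (lt0r_neq0 W0))) mulrBr.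
  rewrite local_mean_sub // (bigD1 i) ?win_refl //= (bigD1 k) ?wk //= big1 => [|l].
    by rewrite addr0 subrr mulr0 add0r /r; apply/eqP; field; rewrite gt_eqF.
  by case/andP=> /andP[wl li] lk; rewrite z // mul0r.
have near : (k.+1%:R = i.+1%:R + 1 :> R /\ k = i.+1 :> nat) \/
            (k.+1%:R = i.+1%:R - 1 :> R /\ i = k.+1 :> nat).
  have := window_near pi pk wk; have : (k : nat) != i by [].
  rewrite neq_ltn => /orP[h|h] /andP[h1 h2].
    have e : i = k.+1 :> nat by lia.
    by right; split=> //; rewrite e -(natr1 k.+1) addrK.
  have e : k = i.+1 :> nat by lia.
  by left; split=> //; rewrite e -(natr1 i.+1).
have [->|ji] := eqVneq j i.
  rewrite win_refl Er EM addrAC subrr add0r.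
  have -> : `|r * (k.+1%:R - i.+1%:R)| = r.
    case: near => -[-> _].
      by rewrite addrAC subrr add0r mulr1 ger0_norm; lra.
    by rewrite addrAC subrr add0r mulrN1 normrN ger0_norm; lra.
  by apply/max_idPr; lra.
have [->|jk] := eqVneq j k.
  rewrite wk -/r EM.
  have -> : `|i.+1%:R + r * (k.+1%:R - i.+1%:R) - k.+1%:R| = 1 - r.
    by case: near => -[-> _]; [rewrite ler0_norm|rewrite ger0_norm]; lra.
  by rewrite opprB addrC subrK; apply/max_idPr; lra.
rewrite (_ : (if _ then _ else _) = 0); last first.
  by case: ifP => // wj; rewrite z // mul0r.
(* The mean lies between the neighbours [i] and [k], so any other label is at distance at least 1
   from it. *)
apply/max_idPl.
have ji' : (j : nat) != i by [].
have jk' : (j : nat) != k by [].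
rewrite EM subr_le0; case: near => -[-> e].
  (* The guard [0 < i] is there because [0.-1 = 0]. *)
  have [h|h] : (j <= i.-1 /\ 0 < i)%N \/ (i.+2 <= j)%N by lia.
    have : j.+1%:R + 1 <= i.+1%:R :> R by rewrite natr1 ler_nat; lia.
    by move=> ?; rewrite ger0_norm; lra.
  have : i.+1%:R + 2 <= j.+1%:R :> R by rewrite -natrD ler_nat; lia.
  by move=> ?; rewrite ler0_norm; lra.
have [h|h] : (j.+2 <= i)%N \/ (i < j)%N by lia.
  have : j.+1%:R + 2 <= i.+1%:R :> R by rewrite -natrD ler_nat; lia.
  by move=> ?; rewrite ger0_norm; lra.
have : i.+1%:R + 1 <= j.+1%:R :> R by rewrite natr1 ler_nat; lia.
by move=> ?; rewrite ler0_norm; lra.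
Qed.

(** Two support points that see each other see the same support points; this makes [p_i p_j / W_i]
    symmetric. *)
Lemma window_mass_eq (i j : 'I_n) : 0 < p 0 i -> 0 < p 0 j -> win eps i j -> W i = W j.
Proof.
have sub (i' j' : 'I_n) : 0 < p 0 i' -> 0 < p 0 j' -> win eps i' j' -> W i' <= W j'.
  move=> pi pj wij; rewrite /W big_mkcond [leRHS]big_mkcond; apply: ler_sum => k _.
  case: ifP => wk; case: ifPn => // wk'.
  have := p_ge0 k; rewrite le_eqVlt => /predU1P[<-//|pk].
  case/negP: wk'; have [<-//|ij] := eqVneq i' j'.
  have [->|->] := window_pair pi pj pk wij wk ij; last exact: win_refl.
  by rewrite win_sym.
move=> pi pj w; apply/eqP; rewrite eq_le !sub //.
by rewrite win_sym.
Qed.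

Lemma separated_fixed j : \sum_i p 0 i * B i j = p 0 j.
Proof.
have := p_ge0 j; rewrite le_eqVlt => /predU1P[pj|pj].
  (* An empty [j] receives nothing: on the support, [B i j] carries the factor [p 0 j]. *)
  rewrite -pj big1 // => i _.
  have := p_ge0 i; rewrite le_eqVlt => /predU1P[<-|pi]; first by rewrite mul0r.
  by rewrite HKmx_separated // -pj mul0r; case: ifP; rewrite mulr0.
have W0 := window_mass_gt0 pj.
(* With [p 0 j] written as [p 0 j * W j / W j] and [W j] expanded, the sums agree term by term by
   detailed balance. *)
rewrite -[RHS](mulfK (lt0r_neq0 W0)) {1}/W mulr_sumr mulr_suml big_mkcond.
rewrite [RHS]big_mkcond; apply: eq_bigr => i _; rewrite (win_sym eps j).
have := p_ge0 i; rewrite le_eqVlt => /predU1P[<-|pi].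
  by rewrite mulr0 !mul0r; case: ifP.
rewrite HKmx_separated //; case: ifP => w; last by rewrite mulr0.
by rewrite (window_mass_eq pi pj w) mulrA (mulrC (p 0 j)).
Qed.

End Separated.
End Chain.

Theorem theorem8 (R : realType) (n eps : nat) (hn : (0 < n)%N)
  (heps : (0 < eps)%N) (hne : (n <= 2)%N || (2 <= eps)%N)
  (p : 'rV[R]_n) (hp : opinion_distribution p) :
  p = p *m HKmx p eps <->
  (forall k : 'I_n, 0 < p 0 k ->
     forall m : 'I_n, 2 <= `|label m - label k| <= eps%:Z -> p 0 m = 0).
Proof.
have [p_ge0 _] := hp; rewrite fixedE; split=> [fixed k pk m|sep].
  have sep := fixed_separated p_ge0 heps fixed.
  have := p_ge0 m; rewrite le_eqVlt => /predU1P[//|pm].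
  by have := sep k m pk pm; have := sep m k pm pk; rewrite /label; lia.
apply: separated_fixed => // i j pi pj ij; rewrite ltnNge; apply/negP => near.
have := sep i pi j; rewrite /label => e; move: pj.
by rewrite e ?ltxx //; lia.
Qed.
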